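(* Let $R$ be a commutative ring with unit, let $V=R\mathbb{N}$ be the free $R$-module with basis $(e_n)_{n\in\mathbb{N}}$, and let $\mu\colon V\otimes_R V\to V$ be the $R$-linear map given by $\mu(e_m\otimes e_n)=e_{m+n}$ for all $m,n\in\mathbb{N}$. Then $(V,\mu,e_0)$ is an $R$-linear monoid, and it is: (1) the free $R$-linear monoid over the set $\{1\}$, with canonical map $1\mapsto e_1$; (2) the free $R$-linear monoid over the $R$-module $R$, with canonical map $\alpha\mapsto\alpha e_1$; (3) the free $R$-linear monoid over the monoid $(\mathbb{N},+,0)$, with canonical map $n\mapsto e_n$.
   Context: An $R$-linear monoid is an $R$-module $W$ with an $R$-linear map $m\colon W\otimes_R W\to W$ and an element $1_W\in W$ such that $m(m(u\otimes v)\otimes w)=m(u\otimes m(v\otimes w))$ and $m(v\otimes 1_W)=v=m(1_W\otimes v)$ for all $u,v,w\in W$ (i.e. an associative unital $R$-algebra, not necessarily commutative). A homomorphism of $R$-linear monoids is an $R$-linear map preserving multiplication and unit. A free $R$-linear monoid over a set (resp. an $R$-module, resp. a monoid) $X$ is an $R$-linear monoid $F$ together with a map (resp. an $R$-linear map, resp. a monoid homomorphism into the multiplicative monoid of $F$) $j\colon X\to F$, called the canonical map, such that for every $R$-linear monoid $W$ and every map (resp. $R$-linear map, resp. monoid homomorphism into the multiplicative monoid of $W$) $\phi\colon X\to W$ there is a unique homomorphism of $R$-linear monoids $\widehat{\phi}\colon F\to W$ with $\widehat{\phi}\circ j=\phi$. *)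

(* Defs.v *)
From HB Require Import structures.
From mathcomp Require Import all_boot all_algebra generic_quotient.
From mathcomp Require Import boolp finmap monalg.

Set Implicit Arguments.
Unset Strict Implicit.
Unset Printing Implicit Defensive.

Import GRing.Theory.

Local Open Scope ring_scope.

Reserved Notation "v ⊗ w" (at level 40, left associativity).

(* The free R-module on the set X, i.e. the finitely supported functions from
   X to R.  The additive structure is that of {malg R[X]}; the module structure
   that monalg puts on {malg R[X]} is only available when 1 != 0 in R, which is
   why it is redefined here for an arbitrary R. *)
Section FreeModule.
Variables (R : pzRingType) (X : choiceType).

Definition freeMod : Type := {malg R[X]}.

HB.instance Definition _ := GRing.Zmodule.copy freeMod {malg R[X]}.

Implicit Types (u v : freeMod) (a b : R) (x y : X).

Definition coef v x : R := mcoeff x v.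

Definition freeMod_scale a v : freeMod :=
  \sum_(x <- msupp v) mkmalgU x (a * coef v x).

Definition basis x : freeMod := mkmalgU x 1.

Lemma coefP u v : (forall x, coef u x = coef v x) -> u = v.
Proof. by move/malgP. Qed.

Lemma coefD u v x : coef (u + v) x = coef u x + coef v x.
Proof. exact: mcoeffD. Qed.

Lemma coef_sum I (r : seq I) (F : I -> freeMod) x :
  coef (\sum_(i <- r) F i) x = \sum_(i <- r) coef (F i) x.
Proof.
by apply: (big_morph (coef^~ x)) => [u v|]; [apply: coefD | apply: mcoeff0].
Qed.

Lemma coef_scale a v x : coef (freeMod_scale a v) x = a * coef v x.
Proof.
transitivity (a * coef (\sum_(y <- msupp v) mkmalgU y (coef v y)) x); last first.
  by congr (a * coef _ x); rewrite [RHS]monalgE.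
rewrite !coef_sum mulr_sumr; apply: eq_bigr => y _.
by rewrite /coef !mcoeffU mulrnAr.
Qed.

Lemma freeMod_scaleA a b v :
  freeMod_scale a (freeMod_scale b v) = freeMod_scale (a * b) v.
Proof. by apply: coefP => x; rewrite !coef_scale mulrA. Qed.

Lemma freeMod_scale1 : left_id 1 freeMod_scale.
Proof. by move=> v; apply: coefP => x; rewrite coef_scale mul1r. Qed.

Lemma freeMod_scaleDr : right_distributive freeMod_scale +%R.
Proof.
by move=> a u v; apply: coefP => x; rewrite !(coefD, coef_scale) mulrDr.
Qed.

Lemma freeMod_scaleDl v : {morph freeMod_scale^~ v : a b / a + b}.
Proof.
by move=> a b; apply: coefP => x; rewrite !(coefD, coef_scale) mulrDl.
Qed.

HB.instance Definition _ := GRing.Zmodule_isLmodule.Build R freeMod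
  freeMod_scaleA freeMod_scale1 freeMod_scaleDr freeMod_scaleDl.

Lemma coefZ a v x : coef (a *: v) x = a * coef v x.
Proof. exact: coef_scale. Qed.

Lemma coef_basis x y : coef (basis x) y = (x == y)%:R.
Proof. exact: mcoeffU. Qed.

Lemma freeModE v : v = \sum_(x <- msupp v) coef v x *: basis x.
Proof.
rewrite [LHS]monalgE; apply: eq_bigr => x _; apply: coefP => y.
by rewrite coefZ coef_basis /coef mcoeffU mulr_natr.
Qed.

End FreeModule.

Section FreeModuleLift.
Variables (R : pzRingType) (X : choiceType) (M : lmodType R) (f : X -> M).

Definition freeMod_lift (v : freeMod R X) : M :=
  \sum_(x <- msupp v) coef v x *: f x.

Lemma freeMod_lift_wide (d : {fset X}) (v : freeMod R X) :
  (msupp v `<=` d)%fset -> freeMod_lift v = \sum_(x <- d) coef v x *: f x.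
Proof.
move=> svd; apply: big_fset_incl => // x _ xv.
by rewrite /coef mcoeff_outdom ?scale0r.
Qed.

Lemma freeMod_lift_linear : linear freeMod_lift.
Proof.
move=> a u v.
pose d := (msupp u `|` msupp v `|` msupp (a *: u + v : freeMod R X))%fset.
have du : (msupp u `<=` d)%fset.
  by apply: fsubset_trans (fsubsetUl _ _); apply: fsubsetUl.
have dv : (msupp v `<=` d)%fset.
  by apply: fsubset_trans (fsubsetUl _ _); apply: fsubsetUr.
have ds : (msupp (a *: u + v : freeMod R X) `<=` d)%fset by apply: fsubsetUr.
rewrite (freeMod_lift_wide du) (freeMod_lift_wide dv) (freeMod_lift_wide ds).
rewrite scaler_sumr -big_split /=.
by apply: eq_bigr => x _; rewrite coefD coefZ scalerDl scalerA.
Qed.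

HB.instance Definition _ :=
  GRing.isLinear.Build R (freeMod R X) M *:%R freeMod_lift freeMod_lift_linear.

Lemma freeMod_lift_basis x : freeMod_lift (basis R x) = f x.
Proof.
rewrite (freeMod_lift_wide (d := [fset x]%fset)); last exact: msuppU_le.
by rewrite big_seq_fset1 coef_basis eqxx scale1r.
Qed.

End FreeModuleLift.

(* The tensor product over R: the quotient of the free module on V * W by the
   submodule generated by the bilinearity relations. *)
Section TensorProduct.
Variables (R : comPzRingType) (V W : lmodType R).

Local Notation d := (fun v w => basis R (v, w) : freeMod R (V * W)%type).

Inductive tensor_null : freeMod R (V * W)%type -> Prop :=
  | tensor_null0 : tensor_null 0
  | tensor_null_lin a u v :
      tensor_null u -> tensor_null v -> tensor_null (a *: u + v)
  | tensor_null_l a v v' w :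
      tensor_null (d (a *: v + v') w - (a *: d v w + d v' w))
  | tensor_null_r a v w w' :
      tensor_null (d v (a *: w + w') - (a *: d v w + d v w')).

Definition tensor_nullb : {pred freeMod R (V * W)%type} :=
  fun u => `[< tensor_null u >].

Fact tensor_nullb_zmod_closed : zmod_closed tensor_nullb.
Proof.
split=> [|u v /asboolP nu /asboolP nv]; apply/asboolP.
  exact: tensor_null0.
by rewrite -scaleN1r addrC; apply: tensor_null_lin.
Qed.

HB.instance Definition _ :=
  GRing.isZmodClosed.Build _ tensor_nullb tensor_nullb_zmod_closed.

Definition tensor : Type := Quotient.quot tensor_nullb.

HB.instance Definition _ := GRing.Zmodule.copy tensor (Quotient.quot tensor_nullb).

Definition tensor_pi (u : freeMod R (V * W)%type) : tensor :=
  (\pi_(Quotient.quot tensor_nullb) u)%qT.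

Definition tensor_repr (t : tensor) : freeMod R (V * W)%type :=
  repr (t : Quotient.quot tensor_nullb).

Definition tensor_scale (a : R) (t : tensor) : tensor :=
  tensor_pi (a *: tensor_repr t).

Definition tens (v : V) (w : W) : tensor := tensor_pi (basis R (v, w)).

Lemma tensor_reprK t : tensor_pi (tensor_repr t) = t.
Proof. exact: reprK. Qed.

Lemma tensor_piP u v : tensor_pi u = tensor_pi v <-> tensor_null (u - v).
Proof.
split=> [/eqP|nuv].
  by rewrite /tensor_pi -Quotient.idealrBE => /asboolP.
by apply/eqP; rewrite /tensor_pi -Quotient.idealrBE; apply/asboolP.
Qed.

Lemma tensor_piD u v : tensor_pi (u + v) = tensor_pi u + tensor_pi v.
Proof. exact: raddfD. Qed.

Lemma tensor_nullZ a u : tensor_null u -> tensor_null (a *: u).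
Proof.
by move=> nu; rewrite -[_ *: _]addr0; apply: tensor_null_lin tensor_null0.
Qed.

Lemma tensor_pi_scale a u : tensor_pi (a *: u) = tensor_scale a (tensor_pi u).
Proof.
apply/tensor_piP; rewrite -scalerBr; apply: tensor_nullZ.
by apply/tensor_piP; rewrite tensor_reprK.
Qed.

Fact tensor_scaleA a b t : tensor_scale a (tensor_scale b t) = tensor_scale (a * b) t.
Proof. by rewrite -[t]tensor_reprK -!tensor_pi_scale scalerA. Qed.

Fact tensor_scale1 : left_id 1 tensor_scale.
Proof. by move=> t; rewrite /tensor_scale scale1r tensor_reprK. Qed.

Fact tensor_scaleDr : right_distributive tensor_scale +%R.
Proof.
move=> a t t'; rewrite -[t]tensor_reprK -[t']tensor_reprK -tensor_piD.
by rewrite -!tensor_pi_scale scalerDr tensor_piD.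
Qed.

Fact tensor_scaleDl t : {morph tensor_scale^~ t : a b / a + b}.
Proof. by move=> a b; rewrite /tensor_scale scalerDl tensor_piD. Qed.

HB.instance Definition _ := GRing.Zmodule_isLmodule.Build R tensor
  tensor_scaleA tensor_scale1 tensor_scaleDr tensor_scaleDl.

Fact tensor_pi_linear : linear tensor_pi.
Proof. by move=> a u v; rewrite tensor_piD tensor_pi_scale. Qed.

HB.instance Definition _ := GRing.isLinear.Build R
  (freeMod R (V * W)%type) tensor *:%R tensor_pi tensor_pi_linear.

End TensorProduct.

Bind Scope ring_scope with tensor.
Notation "V ⊗ W" := (tensor V W) : type_scope.
Notation "v ⊗ w" := (tens v w) : ring_scope.

Section TensorTheory.
Variables (R : comPzRingType) (V W : lmodType R).

Lemma tens_linear_l (w : W) : linear (fun v : V => v ⊗ w).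
Proof.
move=> a v v'; rewrite /tens -linearP; apply/tensor_piP; exact: tensor_null_l.
Qed.

Lemma tens_linear_r (v : V) : linear (fun w : W => v ⊗ w).
Proof.
move=> a w w'; rewrite /tens -linearP; apply/tensor_piP; exact: tensor_null_r.
Qed.

Lemma tensor_sum (t : V ⊗ W) :
  exists s : seq (R * (V * W)), t = \sum_(x <- s) x.1 *: (x.2.1 ⊗ x.2.2).
Proof.
exists [seq (coef (tensor_repr t) x, x) | x <- msupp (tensor_repr t)].
rewrite big_map -[LHS]tensor_reprK [X in tensor_pi X]freeModE linear_sum /=.
by apply: eq_bigr => -[v w] _; rewrite linearZ.
Qed.

Variables (M : lmodType R) (b : V -> W -> M).
Hypotheses (b_linear_l : forall w, linear (b^~ w)).
Hypotheses (b_linear_r : forall v, linear (b v)).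

Let b2 (x : V * W) := b x.1 x.2.

Let L := freeMod_lift b2.

Let LB u u' : L (u - u') = L u - L u'.
Proof. exact: (linearB (freeMod_lift b2)). Qed.

Let L_basis v w : L (basis R (v, w)) = b v w.
Proof. exact: freeMod_lift_basis. Qed.

Lemma tensor_null_lift u : tensor_null u -> L u = 0.
Proof.
elim=> [|a u' v _ u0 _ v0|a v v' w|a v w w'].
- exact: (linear0 (freeMod_lift b2)).
- by rewrite /L freeMod_lift_linear -/L u0 v0 scaler0 addr0.
- rewrite LB {2}/L freeMod_lift_linear -/L !L_basis.
  by rewrite (b_linear_l w a v v') subrr.
- rewrite LB {2}/L freeMod_lift_linear -/L !L_basis.
  by rewrite (b_linear_r v a w w') subrr.
Qed.

Lemma tensor_lift :
  exists! f : V ⊗ W -> M, linear f /\ forall v w, f (v ⊗ w) = b v w.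
Proof.
pose f (t : V ⊗ W) := L (tensor_repr t).
have fpi u : f (tensor_pi u) = L u.
  apply/eqP; rewrite -subr_eq0 -LB; apply/eqP; apply: tensor_null_lift.
  by apply/tensor_piP; rewrite tensor_reprK.
have flin : linear f.
  move=> a t t'; rewrite -[t]tensor_reprK -[t']tensor_reprK.
  rewrite -tensor_pi_linear !fpi; exact: freeMod_lift_linear.
have f_tens v w : f (v ⊗ w) = b v w by rewrite fpi L_basis.
exists f; split=> // g [glin g_tens]; apply: funext => t.
pose fM := GRing.isLinear.Build _ _ _ _ f flin.
pose gM := GRing.isLinear.Build _ _ _ _ g glin.
pose lf : {linear tensor V W -> M} := HB.pack f fM.
pose lg : {linear tensor V W -> M} := HB.pack g gM.
have [s ->] := tensor_sum t.
rewrite -[LHS]/(lf _) -[RHS]/(lg _) !linear_sum.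
by apply: eq_bigr => -[a [v w]] _; rewrite !linearZ /= g_tens f_tens.
Qed.

End TensorTheory.

(* These are the objects of algType R, except that algType excludes the zero
   algebra: a linear monoid is allowed to satisfy 1 = 0. *)
Section LinearMonoids.
Variable R : comPzRingType.

Record is_linMonoid (W : lmodType R) (m : W ⊗ W -> W) (one : W) : Prop := {
  linMonoid_linear : linear m;
  linMonoid_mulA : forall u v w, m (m (u ⊗ v) ⊗ w) = m (u ⊗ m (v ⊗ w));
  linMonoid_mul1r : forall v, m (one ⊗ v) = v;
  linMonoid_mulr1 : forall v, m (v ⊗ one) = v
}.

Record linMonoid := LinMonoid {
  carrier :> lmodType R;
  lmul : carrier ⊗ carrier -> carrier;
  lone : carrier;
  linMonoidP : is_linMonoid lmul lone
}.

Definition is_linMonoid_hom (F W : linMonoid) (f : F -> W) : Prop :=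
  [/\ linear f,
      forall x y, f (lmul (x ⊗ y)) = lmul (f x ⊗ f y) &
      f (lone F) = lone W].

(* A homomorphism from the monoid (X, op, e) to (W, m, 1_W). *)
Definition is_monoid_hom (X : Type) (e : X) (op : Monoid.law e)
    (W : linMonoid) (f : X -> W) : Prop :=
  (forall x y, f (op x y) = lmul (f x ⊗ f y)) /\ f e = lone W.

Definition free_over_set (X : Type) (F : linMonoid) (j : X -> F) : Prop :=
  forall (W : linMonoid) (phi : X -> W),
    exists! f : F -> W, is_linMonoid_hom f /\ f \o j = phi.

Definition free_over_module (M : lmodType R) (F : linMonoid) (j : M -> F) :
    Prop :=
  linear j /\
  forall (W : linMonoid) (phi : M -> W), linear phi ->
    exists! f : F -> W, is_linMonoid_hom f /\ f \o j = phi.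

Definition free_over_monoid (X : Type) (e : X) (op : Monoid.law e)
    (F : linMonoid) (j : X -> F) : Prop :=
  is_monoid_hom op j /\
  forall (W : linMonoid) (phi : X -> W), is_monoid_hom op phi ->
    exists! f : F -> W, is_linMonoid_hom f /\ f \o j = phi.

End LinearMonoids.

Arguments free_over_set {R X} F j.
Arguments free_over_module {R} M F j.
Arguments free_over_monoid {R X e} op F j.

(* Main.v *)
(** A homomorphism out of R[X], for a monoid X, is determined by its values on
   the basis X, and the linear extension of a monoid homomorphism is
   multiplicative because both sides are bilinear and agree on X * X; this gives
   (3) for every monoid X.  Then (1) holds because a monoid homomorphism from nat
   is the same as an element, its value at 1, and (2) holds because a linear map
   from R is the same as an element, its value at 1. *)

Require Import Defs.
From HB Require Import structures.
From mathcomp Require Import all_boot all_algebra.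
From mathcomp Require Import boolp finmap monalg.

Import GRing.Theory.
Local Open Scope ring_scope.

Lemma linear_comp {R : pzRingType} {U V W : lmodType R} (f : V -> W) (g : U -> V) :
  linear f -> linear g -> linear (f \o g).
Proof. by move=> lf lg a u v; rewrite /= lg lf. Qed.

Lemma linear_0 {R : pzRingType} {U V : lmodType R} (f : U -> V) :
  linear f -> f 0 = 0.
Proof. by move=> lf; rewrite -[0](addNr 0) -scaleN1r lf scaleN1r addNr. Qed.

Lemma linear_scale {R : pzRingType} {U V : lmodType R} (f : U -> V) :
  linear f -> forall a u, f (a *: u) = a *: f u.
Proof. by move=> lf a u; rewrite -[a *: u]addr0 lf linear_0 ?addr0. Qed.

Lemma linear_sum_scale {R : pzRingType} {U V : lmodType R} (f : U -> V)
    (I : Type) (s : seq I) (c : I -> R) (g : I -> U) :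
  linear f -> f (\sum_(i <- s) c i *: g i) = \sum_(i <- s) c i *: f (g i).
Proof.
move=> lf; elim: s => [|i s IHs]; first by rewrite !big_nil linear_0.
by rewrite !big_cons lf IHs.
Qed.

Lemma freeMod_linear_ext {R : pzRingType} {X : choiceType} {M : lmodType R}
    (f g : freeMod R X -> M) :
    linear f -> linear g -> (forall x, f (basis R x) = g (basis R x)) -> f =1 g.
Proof.
move=> lf lg fg v; rewrite [v]freeModE !linear_sum_scale //.
by apply: eq_bigr => x _; rewrite fg.
Qed.

(** The one-variable case is applied twice: [v] is reduced to a basis vector with [w] fixed, then
    [w] is. *)
Lemma freeMod_bilinear_ext {R : pzRingType} {X Y : choiceType} {M : lmodType R}
    (b c : freeMod R X -> freeMod R Y -> M) :
    (forall w, linear (b^~ w)) -> (forall v, linear (b v)) ->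
    (forall w, linear (c^~ w)) -> (forall v, linear (c v)) ->
    (forall x y, b (basis R x) (basis R y) = c (basis R x) (basis R y)) ->
  forall v w, b v w = c v w.
Proof.
move=> bl br cl cr bc v w.
apply: (freeMod_linear_ext (b^~ w) (c^~ w)) => // x.
exact: (freeMod_linear_ext (b _) (c _)).
Qed.

Lemma tensor_linear_ext {R : comPzRingType} {V W M : lmodType R}
    (f g : V ⊗ W -> M) :
    linear f -> linear g -> (forall v w, f (v ⊗ w) = g (v ⊗ w)) -> f = g.
Proof.
move=> lf lg fg; apply: funext => t; have [s ->] := tensor_sum t.
by rewrite !linear_sum_scale //; apply: eq_bigr => x _; rewrite fg.
Qed.

Section BilinearMaps.
Context {R : comPzRingType} {V W M : lmodType R} {m : V ⊗ W -> M}.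
Hypothesis m_lin : linear m.

Lemma linear_tens_l w : linear (fun v : V => m (v ⊗ w)).
Proof. exact: linear_comp m_lin (tens_linear_l w). Qed.

Lemma linear_tens_r v : linear (fun w : W => m (v ⊗ w)).
Proof. exact: linear_comp m_lin (tens_linear_r v). Qed.

End BilinearMaps.

Section MonoidAlgebra.
Variables (R : comPzRingType) (X : choiceType) (i : X) (op : Monoid.law i).
Local Notation V := (freeMod R X).
Local Notation e := (@basis R X).

(** This characterizes the multiplication of the monoid algebra $R[X]$. *)
Definition extends_op (mu : V ⊗ V -> V) : Prop :=
  linear mu /\ forall x y, mu (e x ⊗ e y) = e (op x y).

(** Existence comes from the universal property of the tensor product, applied to the bilinear
    extension of [op]. Uniqueness holds because pure tensors span [V ⊗ V] and basis vectors span
    [V]. *)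
Lemma extends_op_exists_unique : exists! mu, extends_op mu.
Proof.
pose b (v w : V) := freeMod_lift (fun x => freeMod_lift (fun y => e (op x y)) w) v.
have bl w : linear (b^~ w) by exact: freeMod_lift_linear.
have bE v w :
  b v w = \sum_(x <- msupp v) coef v x *: freeMod_lift (fun y => e (op x y)) w by [].
(* Here commutativity of [R] enters: the scalar [a] has to move past the coefficients of [v]. *)
have br v : linear (b v).
  move=> a w w'; rewrite !bE scaler_sumr -big_split; apply: eq_bigr => x _ /=.
  by rewrite freeMod_lift_linear scalerDr !scalerA mulrC.
have [mu [[mu_lin muE] _]] := tensor_lift bl br.
have mu_ext : extends_op mu.
  by split=> // x y; rewrite muE /b !freeMod_lift_basis.
exists mu; split=> // nu [nu_lin nuE]; apply: tensor_linear_ext => //.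
apply: (freeMod_bilinear_ext (fun v w => mu (v ⊗ w)) (fun v w => nu (v ⊗ w))).
- exact: linear_tens_l.
- exact: linear_tens_r.
- exact: linear_tens_l.
- exact: linear_tens_r.
- by move=> x y; rewrite mu_ext.2 nuE.
Qed.

(* Stated for curried products: failed matches of v ⊗ w against a pattern make
   Rocq unfold the quotient. *)
Section CurriedProduct.
Context {m : V -> V -> V}.
Hypothesis m_lin_l : forall w, linear (m^~ w).
Hypothesis m_lin_r : forall v, linear (m v).
Hypothesis mE : forall x y, m (e x) (e y) = e (op x y).

(** Both sides are linear in each variable, so [u] and [v], and then [w], may be taken in the basis,
    where associativity of [op] applies. *)
Lemma extends_op_mulA u v w : m (m u v) w = m u (m v w).
Proof.
apply: (freeMod_bilinear_ext (fun u v => m (m u v) w) (fun u v => m u (m v w)))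
  => {u v} [v|u|v|u|x y].
- exact: linear_comp (m_lin_l w) (m_lin_l v).
- exact: linear_comp (m_lin_l w) (m_lin_r u).
- exact: m_lin_l.
- exact: linear_comp (m_lin_r u) (m_lin_l w).
apply: (freeMod_linear_ext (m (m (e x) (e y))) (fun w => m (e x) (m (e y) w))).
- exact: m_lin_r.
- exact: linear_comp (m_lin_r _) (m_lin_r _).
by move=> z; rewrite !mE Monoid.mulmA.
Qed.

Lemma extends_op_mul1r v : m (e i) v = v.
Proof.
apply: (freeMod_linear_ext (m (e i)) id) => // x.
by rewrite mE Monoid.mul1m.
Qed.

Lemma extends_op_mulr1 v : m v (e i) = v.
Proof.
apply: (freeMod_linear_ext (m^~ (e i)) id) => // x.
by rewrite mE Monoid.mulm1.
Qed.

End CurriedProduct.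

Context {mu : V ⊗ V -> V}.
Hypothesis mu_ext : extends_op mu.

Lemma extends_op_linMonoid : is_linMonoid mu (e i).
Proof.
have [mu_lin muE] := mu_ext.
have l w := linear_tens_l mu_lin w; have r v := linear_tens_r mu_lin v.
pose m v w := mu (v ⊗ w).
split; first exact: mu_lin.
- exact: (extends_op_mulA (m := m) l r muE).
- exact: (extends_op_mul1r (m := m) r muE).
- exact: (extends_op_mulr1 (m := m) l muE).
Qed.

Lemma extends_op_free_over_monoid (H : is_linMonoid mu (e i)) :
  free_over_monoid op (LinMonoid H) e.
Proof.
have [mu_lin muE] := mu_ext.
split=> [|W phi [phiM phi1]]; first by split=> // x y; rewrite /= muE.
have W_lin := linMonoid_linear (linMonoidP W).
have L_lin := freeMod_lift_linear phi.
exists (freeMod_lift phi); split=> [|g [[g_lin _ _] gE]].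
  split; last by apply: funext => x /=; rewrite freeMod_lift_basis.
  split=> // [v w|]; last by rewrite /= freeMod_lift_basis.
  apply: (freeMod_bilinear_ext (fun v w => freeMod_lift phi (mu (v ⊗ w)))
    (fun v w => lmul (freeMod_lift phi v ⊗ freeMod_lift phi w)))
    => {v w} [w|v|w|v|x y].
  - exact: linear_comp L_lin (linear_tens_l mu_lin w).
  - exact: linear_comp L_lin (linear_tens_r mu_lin v).
  - exact: linear_comp (linear_tens_l W_lin _) L_lin.
  - exact: linear_comp (linear_tens_r W_lin _) L_lin.
  - by rewrite muE !freeMod_lift_basis phiM.
(* Uniqueness: [phi] prescribes [g] on the basis, and [g] is linear. *)
apply: funext; apply: freeMod_linear_ext => // x.
by rewrite freeMod_lift_basis -gE.
Qed.

End MonoidAlgebra.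

Section Powers.
Context {R : comPzRingType} {W : linMonoid R}.

(** Multiplying on the left matches the recursion of [addn] on its first argument. *)
Definition lpow (w : W) (n : nat) : W := iter n (fun x => lmul (w ⊗ x)) (lone W).

Lemma lpow1 w : lpow w 1 = w.
Proof. exact: (linMonoid_mulr1 (linMonoidP W)). Qed.

Lemma lpow_monoid_hom w : is_monoid_hom addn (lpow w).
Proof.
split=> // m n; elim: m => [|m IHm] /=.
  by rewrite (linMonoid_mul1r (linMonoidP W)).
by rewrite IHm (linMonoid_mulA (linMonoidP W)).
Qed.

(** Reading [n.+1] as [1 + n] turns multiplicativity of [f] into the recursion that defines
    [lpow]. *)
Lemma nat_monoid_homE (f : nat -> W) : is_monoid_hom addn f -> f = lpow (f 1%N).
Proof.
move=> [fM f1]; apply: funext; elim=> [//|n IHn].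
by rewrite -add1n fM IHn.
Qed.

End Powers.

Lemma comp_monoid_hom {R : comPzRingType} {X : Type} {i : X} (op : Monoid.law i)
    {F W : linMonoid R} (f : F -> W) (j : X -> F) :
  is_linMonoid_hom f -> is_monoid_hom op j -> is_monoid_hom op (f \o j).
Proof. by move=> [_ fM f1] [jM j1]; split=> [x y|] /=; rewrite ?jM ?j1. Qed.

Lemma free_over_nat_unit {R : comPzRingType} {F : linMonoid R} (j : nat -> F) :
  free_over_monoid addn F j -> free_over_set F (fun _ : unit => j 1%N).
Proof.
move=> [j_hom jP] W phi.
(* The monoid homomorphism to extend sends [n] to the [n]-th power of [phi tt]. *)
have [f [[f_hom fj] f_uniq]] := jP W _ (lpow_monoid_hom (phi tt)).
exists f; split=> [|g [g_hom gj]].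
  by split=> //; apply: funext => -[] /=; rewrite -[f _]/((f \o j) 1%N) fj lpow1.
apply: f_uniq; split=> //.
(* As a monoid homomorphism, [g \o j] consists of the powers of its value at [1], which is [phi tt]
   by [gj]. *)
rewrite (nat_monoid_homE _ (comp_monoid_hom _ _ _ g_hom j_hom)).
by rewrite -(congr1 (@^~ tt) gj).
Qed.

Lemma free_over_unit_ring {R : comPzRingType} {F : linMonoid R} (w : F) :
  free_over_set F (fun _ : unit => w) ->
  free_over_module R^o F (fun a : R => a *: w).
Proof.
move=> wP; split=> [a b c|W phi phi_lin]; first by rewrite scalerDl scalerA.
(* Scaling in [R^o] is multiplication in [R], so [a] equals [a *: 1]. *)
have phiE a : phi a = a *: phi 1.
  by rewrite -(linear_scale _ phi_lin) /GRing.scale /= mulr1.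
have [f [[f_hom fw] f_uniq]] := wP W (fun _ => phi 1).
exists f; split=> [|g [g_hom gw]].
  split=> //; apply: funext => a; case: f_hom => f_lin _ _.
  by rewrite /= (linear_scale _ f_lin) phiE -(congr1 (@^~ tt) fw).
apply: f_uniq; split=> //; apply: funext => -[].
by rewrite -gw /= scale1r.
Qed.

Theorem mainTheorem3 (R : comPzRingType) :
  let V := freeMod R nat in
  let e : nat -> V := @basis R nat in
  let is_mu (mu : V ⊗ V -> V) :=
    linear mu /\ forall m n : nat, mu (e m ⊗ e n) = e (m + n)%N in
  (exists! mu : V ⊗ V -> V, is_mu mu) /\
  forall mu : V ⊗ V -> V, is_mu mu ->
    exists H : is_linMonoid mu (e 0%N),
      let F := LinMonoid H in
      [/\ free_over_set F (fun _ : unit => e 1%N),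
          free_over_module R^o F (fun a : R => a *: e 1%N) &
          free_over_monoid addn F e].
Proof.
(* [is_mu] is [extends_op] for [addn] written out. *)
move=> V e is_mu; split; first exact: (extends_op_exists_unique R nat 0%N addn).
move=> mu mu_ext; have H : is_linMonoid mu (e 0%N).
  exact: (extends_op_linMonoid R nat 0%N addn mu_ext).
exists H => F.
have F_nat : free_over_monoid addn F e by exact: extends_op_free_over_monoid.
have F_unit := @free_over_nat_unit R F e F_nat.
by split=> //; apply: free_over_unit_ring F_unit.
Qed.
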